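(* For every $n\ge1$ and every $X\in\mathfrak B^n$, $h^{\star}(n,X)\le 2^{\iota(2,n)}$.
   Context: $\mathfrak B^n=\{0,1\}^n$ is regarded as $\mathbb F_2^n$; vectors are indexed $X=[X_0,\dots,X_{n-1}]$ with indices modulo $n$. For a rule $X\in\mathfrak B^n$, the additive cellular automaton $\mathfrak A(n,X)$ on the cylinder of size $n$ has state set $\mathfrak B^n$ and transition map the linear operator $\hat X$, $(\hat X*s)_i=\bigoplus_{k=0}^{n-1}X_k s_{i+k\bmod n}$. A state $s$ is cyclic if $\hat X^t*s=s$ for some $t\ge1$. The height $h^{\star}(n,X)$ is the maximum over all states $s$ of the least $t\ge0$ such that $\hat X^t*s$ is cyclic (so it is $0$ iff all states are cyclic). $\iota(2,n)$ is the exponent of the largest power of $2$ dividing $n$. *)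

(* Defs.v *)
From HB Require Import structures.
From mathcomp Require Import all_boot all_order all_algebra.

Set Implicit Arguments.
Unset Strict Implicit.
Unset Printing Implicit Defensive.

Import GRing.Theory.

Local Open Scope ring_scope.

(* Rules and states: {0,1}^n as the F_2-vector space of row vectors. *)
Notation binvec n := 'rV['F_2]_n.

Fact ord_modulus_gt0 n (i : 'I_n) : (0 < n)%N.
Proof. exact: leq_ltn_trans (leq0n i) (ltn_ord i). Qed.

(* The index i + k mod n; 'I_n has its own addition only when n is
   syntactically a successor. *)
Definition ord_shift n (i k : 'I_n) : 'I_n :=
  Ordinal (ltn_pmod (i + k)%N (ord_modulus_gt0 i)).

Definition ca_step n (X s : binvec n) : binvec n :=
  \row_(i < n) \sum_(k < n) X 0 k * s 0 (ord_shift i k).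

Definition cyclic_state n (X s : binvec n) : Prop :=
  exists2 t, (0 < t)%N & iter t (ca_step X) s = s.

(* A boolean form of cyclic_state, so that ex_minn applies below. *)
Definition cyclic_stateb n (X s : binvec n) : bool :=
  fconnect (ca_step X) (ca_step X s) s.

Lemma cyclic_stateP n (X s : binvec n) :
  reflect (cyclic_state X s) (cyclic_stateb X s).
Proof.
apply: (iffP idP) => [/iter_findex fs | [[//|t] _ fs]].
  by exists (findex (ca_step X) (ca_step X s) s).+1; rewrite // iterSr.
by rewrite /cyclic_stateb -[X in fconnect _ _ X]fs iterSr fconnect_iter.
Qed.

Lemma ex_cyclic_state n (X s : binvec n) :
  exists t, cyclic_stateb X (iter t (ca_step X) s).
Proof.
pose f := ca_step X.
have /trajectP[t lt_t ft] := looping_order f s.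
exists t; apply/cyclic_stateP; exists (order f s - t)%N; first by rewrite subn_gt0.
by rewrite -iterD subnK 1?ltnW // -/f ft.
Qed.

Definition transient_length n (X s : binvec n) : nat :=
  ex_minn (ex_cyclic_state X s).

Definition height n (X : binvec n) : nat :=
  (\max_(s : binvec n) transient_length X s)%N.

(* Main.v *)
(* Over F_2 the cross terms in the square of A = sum_k X_k S^k (S the cyclic
   shift) cancel, so A^(2^a) = sum_k X_k S^(2^a k), which depends only on
   2^a mod n.  Writing n = q m with q = 2^(iota(2,n)) and m odd, Euler's theorem
   gives q 2^phi(m) = q mod n, so A^(q 2^phi(m)) = A^q and every state in the
   image of A^q is cyclic. *)
Require Import Defs.
From HB Require Import structures.
From mathcomp Require Import all_boot all_order all_algebra.
From mathcomp Require Import cyclic.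

Set Implicit Arguments.
Unset Strict Implicit.
Unset Printing Implicit Defensive.

Import GRing.Theory.
Local Open Scope ring_scope.

(** Off the diagonal the terms at (k, l) and (l, k) are equal, so each such pair cancels in
    characteristic 2. *)
Lemma sum_sym_pchar2 (R : nzRingType) n (f : 'I_n -> 'I_n -> R) :
  2 \in [pchar R] -> (forall k l, f k l = f l k) ->
  \sum_(k < n) \sum_(l < n) f k l = \sum_(k < n) f k k.
Proof.
move=> R2 f_sym.
have split_row (k : 'I_n) : \sum_(l < n) f k l =
    f k k + (\sum_(l < n | (l < k)%N) f k l + \sum_(l < n | (k < l)%N) f k l).
  rewrite (bigD1 k) //= (bigID (fun l : 'I_n => (l < k)%N)) /=.
  congr (_ + (_ + _)); apply: eq_bigl => l;
    by rewrite -val_eqE /=; case: ltngtP.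
rewrite (eq_bigr _ (fun k _ => split_row k)) !big_split /=.
(* Swapping the two summations reflects the upper triangle onto the lower one; [f_sym] then
   identifies their sums. *)
rewrite [X in _ + (_ + X)](exchange_big_dep xpredT) //=.
rewrite [X in _ + (_ + X)](_ : _ = \sum_(k < n) \sum_(l < n | (l < k)%N) f k l).
  by rewrite addrr_pchar2 // addr0.
by apply: eq_bigr => k _; apply: eq_bigr => l _.
Qed.

Lemma mulFF2 (x : 'F_2) : x * x = x.
Proof. by apply: val_inj; case: x => [[|[|]]]. Qed.

(** Unlike in [ord_shift], the offset is any natural number, since 2^a k may exceed n. *)
Definition shift_by n (i : 'I_n) (d : nat) : 'I_n :=
  Ordinal (ltn_pmod (i + d)%N (ord_modulus_gt0 i)).

(** The operator sum_k X_k S^(d k). *)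
Definition dilated_step n (d : nat) (X s : binvec n) : binvec n :=
  \row_(i < n) \sum_(k < n) X 0 k * s 0 (shift_by i (d * k)).

Lemma dilated_step_mod n d e (X s : binvec n) :
  d = e %[mod n] -> dilated_step d X s = dilated_step e X s.
Proof.
move=> de; apply/rowP => i; rewrite !mxE; apply: eq_bigr => k _.
congr (_ * s 0 _); apply: val_inj => /=.
by rewrite -modnDmr -modnMml de modnMml modnDmr.
Qed.

(** The composite is the double sum of X_k X_l S^(d k + d l), symmetric in k and l; only its
    diagonal survives, where X_k^2 = X_k. *)
Lemma dilated_step_double n d (X s : binvec n) :
  dilated_step d X (dilated_step d X s) = dilated_step (d + d) X s.
Proof.
have shift_shift (i : 'I_n) a b :
    shift_by (shift_by i a) b = shift_by i (a + b).
  by apply: val_inj; rewrite /= modnDml addnA.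
apply/rowP => i; rewrite !mxE.
under eq_bigr => k _.
  rewrite mxE mulr_sumr.
  under eq_bigr => l _ do rewrite shift_shift mulrA.
  over.
rewrite sum_sym_pchar2 ?pchar_Fp //; last first.
  by move=> k l; rewrite addnC [X 0 k * _]mulrC.
by apply: eq_bigr => k _; rewrite mulFF2 mulnDl.
Qed.

Lemma iter_ca_step_pow2 n a (X s : binvec n) :
  iter (2 ^ a) (ca_step X) s = dilated_step (2 ^ a) X s.
Proof.
elim: a s => [|a IHa] s.
  apply/rowP => i; rewrite !mxE; apply: eq_bigr => k _.
  by congr (_ * s 0 _); apply: val_inj; rewrite /= mul1n.
by rewrite expnS mul2n -addnn iterD !IHa dilated_step_double.
Qed.

Lemma pow2_mod_period n : (0 < n)%N ->
  exists2 j, (0 < j)%N & (2 ^ (logn 2 n + j) = 2 ^ logn 2 n %[mod n])%N.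
Proof.
move=> n_gt0; have [m m_odd def_n] := pfactor_coprime (isT : prime 2) n_gt0.
have m_gt0 : (0 < m)%N by move: n_gt0; rewrite def_n muln_gt0 => /andP[].
exists (totient m); first by rewrite totient_gt0.
(* Only the modulus is factored, as n also occurs in the exponents. Pulling 2^(logn 2 n) out of the
   remainder leaves 2^phi(m) modulo the odd m. *)
rewrite [in X in _ = _ %[mod X]]def_n mulnC expnD -!muln_modr.
by rewrite Euler_exp_totient // muln_modr muln1.
Qed.

Lemma transient_length_le n (X s : binvec n) t :
  cyclic_state X (iter t (ca_step X) s) -> (transient_length X s <= t)%N.
Proof.
move=> /cyclic_stateP cyc; rewrite /transient_length.
by case: ex_minnP => u _; apply.
Qed.

Theorem theorem4 (n : nat) (hn : (1 <= n)%N) (X : binvec n) :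
  (height X <= 2 ^ logn 2 n)%N.
Proof.
apply/bigmax_leqP => s _; apply: transient_length_le.
have [j j_gt0 period] := pow2_mod_period hn.
have lt_q : (2 ^ logn 2 n < 2 ^ (logn 2 n + j))%N.
  by rewrite ltn_exp2l // -[X in (X < _)%N]addn0 ltn_add2l.
(* The orbit of s is in the same state at both times, so their difference is a period. *)
exists (2 ^ (logn 2 n + j) - 2 ^ logn 2 n)%N; first by rewrite subn_gt0.
rewrite -iterD subnK 1?ltnW // !iter_ca_step_pow2.
exact: dilated_step_mod.
Qed.
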